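(* Let $\mathcal{H}$ be a real Hilbert space and let $A:\mathcal{H}\to 2^{\mathcal{H}}$ be maximally monotone with $\operatorname{zer}A\neq\varnothing$. Let $x_0\in\mathcal{H}$, let $(\lambda_k)_{k\in\mathbb{N}}$ be in $[0,2]$, let $(c_k)_{k\in\mathbb{N}}$ be in $\mathbb{R}_{++}$, and let $$(\forall k\in\mathbb{N})\quad x_{k+1}=(1-\lambda_k)x_k+\lambda_k \operatorname{J}_{c_kA}x_k .$$ Let $\bar{x}\in\operatorname{zer}A$. Suppose that $A$ is metrically subregular at $\bar{x}$ for $0\in A\bar{x}$, i.e., there are $\kappa>0$ and $\delta>0$ (fixed from now on) such that $(\forall x\in B[\bar{x};\delta])$ $\operatorname{d}(x,A^{-1}0)\leq\kappa\operatorname{d}(0,Ax)$. Set $c:=\inf_{k\in\mathbb{N}}c_k$. Then the following hold. (i) Suppose that $x_0\in B[\bar{x};\delta]$ and that $\lambda_k=1$ for all $k\in\mathbb{N}$. Then: (a) $(\forall k\in\mathbb{N})$ $\operatorname{d}(x_{k+1},\operatorname{zer}A)\leq\frac{1}{\sqrt{1+c_k^2/\kappa^2}}\operatorname{d}(x_k,\operatorname{zer}A)$; (b) if $c>0$, then $(x_k)_{k\in\mathbb{N}}$ converges $R$-linearly to a point $\hat{x}\in\operatorname{zer}A$. (ii) Suppose that $x_k\to\bar{x}$ (strongly). Then: (a) Set $(\forall k\in\mathbb{N})$ $\rho_k:=\left(1-\lambda_k(2-\lambda_k)\frac{1}{(1+\kappa/c_k)^2}\right)^{1/2}$. Then (1)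 there exists $K\in\mathbb{N}$ such that $(\forall k\geq K)$ $\operatorname{d}(x_{k+1},\operatorname{zer}A)\leq\rho_k\operatorname{d}(x_k,\operatorname{zer}A)$; (2) if $c>0$ and $0<\inf_{k\in\mathbb{N}}\lambda_k\leq\sup_{k\in\mathbb{N}}\lambda_k<2$, then $(x_k)_{k\in\mathbb{N}}$ converges $R$-linearly to a point $\hat{x}\in\operatorname{zer}A$. (b) Suppose that $\lambda_k=1$ for all $k\in\mathbb{N}$. Then (1) there exists $K\in\mathbb{N}$ such that $(\forall k\geq K)$ $\operatorname{d}(x_{k+1},\operatorname{zer}A)\leq\frac{1}{\sqrt{1+c_k^2/\kappa^2}}\operatorname{d}(x_k,\operatorname{zer}A)$; (2) if $c>0$, then $(x_k)_{k\in\mathbb{N}}$ converges $R$-linearly to a point $\hat{x}\in\operatorname{zer}A$.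
   Context: $\mathbb{N}=\{0,1,2,\ldots\}$, $\mathbb{R}_{++}$ is the set of positive reals. For a set-valued operator $A$: $\operatorname{zer}A=A^{-1}0=\{x\in\mathcal{H}:0\in Ax\}$. The resolvent is $\operatorname{J}_{\gamma A}=(\operatorname{Id}+\gamma A)^{-1}$, which for maximally monotone $A$ and $\gamma>0$ is single-valued with full domain. $B[\bar{x};r]$ is the closed ball of center $\bar{x}$ and radius $r$. $\operatorname{d}(x,C)=\inf_{y\in C}\|x-y\|$, with $\inf\varnothing=+\infty$. A sequence $(y_k)_{k\in\mathbb{N}}$ converging (strongly) to $\bar{y}$ converges $R$-linearly to $\bar{y}$ if $\limsup_{k\to\infty}\|y_k-\bar{y}\|^{1/k}<1$. *)

(* Defs.v *)
From HB Require Import structures.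
From mathcomp Require Import all_boot all_order all_algebra sesquilinear.
From mathcomp Require Import all_classical all_reals all_analysis.

Set Implicit Arguments.
Unset Strict Implicit.
Unset Printing Implicit Defensive.

Import Order.TTheory GRing.Theory Num.Theory.
Import numFieldNormedType.Exports.

Local Open Scope classical_set_scope.
Local Open Scope ring_scope.

(* A real Hilbert space is a complete normed module whose norm comes from an
   inner product. *)
HB.mixin Record NormedModule_isHilbert (R : realType) H
    & NormedModule R H := {
  inner : {dot H for (@idfun R)} ;
  inner_normE : forall x : H, inner x x = `|x| ^+ 2
}.

#[short(type="hilbertType")]
HB.structure Definition Hilbert (R : realType) :=
  {H of CompleteNormedModule R H & NormedModule_isHilbert R H}.

(* A set-valued operator H -> 2^H is a function H -> set H; "A x u" means that
   (x, u) lies in the graph of A. *)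
Section SetValuedOperators.
Context {R : realType} {H : hilbertType R}.
Implicit Types (A B : H -> set H) (x y u v : H) (C : set H).

Definition op_inv A : H -> set H := fun u => [set x | A x u].

Definition zer A : set H := op_inv A 0.

Definition monotone A : Prop :=
  forall x y u v, A x u -> A y v -> 0 <= inner (x - y) (u - v).

Definition maximally_monotone A : Prop :=
  monotone A /\
  forall B, monotone B -> (forall x, A x `<=` B x) -> forall x, B x `<=` A x.

(* J_(g A) = (Id + g A)^-1, kept as a set-valued operator. *)
Definition resolvent (g : R) A : H -> set H :=
  op_inv (fun x => [set x + g *: u | u in A x]).

(* The value is +oo when C is empty. *)
Definition dist x C : \bar R := ereal_inf [set `|x - y|%:E | y in C].

Definition metrically_subregular A x u (kappa delta : R) : Prop :=
  [/\ 0 < kappa, 0 < delta &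
    forall z, closed_ball_ Num.norm x delta z ->
      (dist z (op_inv A u) <= kappa%:E * dist u (A z))%E].

(* The term of index 0, whose exponent is the junk value 0^-1 = 0, does not
   affect the limsup. *)
Definition converges_R_linearly (y : nat -> H) (ybar : H) : Prop :=
  y @ \oo --> ybar /\
  (limn_esup (fun k => (`|y k - ybar| `^ k%:R^-1)%:E) < 1)%E.

End SetValuedOperators.

(* Main.v *)
(* Write p_k = J_{c_k A} x_k.  Since (x_k - p_k) / c_k belongs to A p_k,
   monotonicity gives |p_k - z|^2 + |x_k - p_k|^2 <= |x_k - z|^2 for every zero
   z, and metric subregularity gives d(p_k, zer A) <= (kappa / c_k)|x_k - p_k|
   as soon as x_k lies in the ball.  Combining the two and taking the infimum
   over z (no projection onto zer A is needed) yields both contraction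
   estimates.  The sequence is Fejer monotone with respect to zer A, so that
   |x_m - x_k| <= 2 d(x_k, zer A) for m >= k: a uniform contraction rate makes
   it Cauchy with geometric speed, and its limit is a zero because zer A is
   closed. *)

Require Import Defs.
From mathcomp Require Import all_boot all_order all_algebra.
From mathcomp Require Import all_classical all_reals all_analysis.
From mathcomp Require Import sesquilinear ring lra.

Set Implicit Arguments.
Unset Strict Implicit.
Unset Printing Implicit Defensive.

Import Order.TTheory GRing.Theory Num.Theory.
Import numFieldNormedType.Exports.

Local Open Scope classical_set_scope.
Local Open Scope ring_scope.

(** * Inner product identities and Cauchy-Schwarz *)

Lemma inner_sym {R : realType} {H : hilbertType R} (a b : H) :
  inner a b = inner b a.
Proof. by rewrite (hermC (inner : {dot H for idfun})) expr0 mul1r. Qed.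

Lemma innerDl {R : realType} {H : hilbertType R} (a b c : H) :
  inner (a + b) c = inner a c + inner b c.
Proof. exact: linearDl. Qed.

Lemma innerZl {R : realType} {H : hilbertType R} (t : R) (a b : H) :
  inner (t *: a) b = t * inner a b.
Proof. exact: linearZl_LR. Qed.

Lemma innerZr {R : realType} {H : hilbertType R} (t : R) (a b : H) :
  inner a (t *: b) = t * inner a b.
Proof. by rewrite inner_sym innerZl inner_sym. Qed.

Lemma inner0l {R : realType} {H : hilbertType R} (a : H) : inner 0 a = 0.
Proof. by have := innerZl 0 0 a; rewrite scale0r mul0r. Qed.

Lemma normD_sqr {R : realType} {H : hilbertType R} (a b : H) :
  `|a + b| ^+ 2 = `|a| ^+ 2 + 2 * inner a b + `|b| ^+ 2.
Proof.
rewrite -!inner_normE innerDl (inner_sym a) (inner_sym b) !innerDl.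
by rewrite (inner_sym b a); ring.
Qed.

Lemma norm_convex_sqr {R : realType} {H : hilbertType R} (t : R) (a b : H) :
  `|(1 - t) *: a + t *: b| ^+ 2 =
  (1 - t) * `|a| ^+ 2 + t * `|b| ^+ 2 - t * (1 - t) * `|a - b| ^+ 2.
Proof.
rewrite -(scaleN1r b) !normD_sqr !normrZ innerZl !innerZr.
rewrite !exprMn !real_normK ?num_real//; ring.
Qed.

Lemma inner_le_norm {R : realType} {H : hilbertType R} (a b : H) :
  inner a b <= `|a| * `|b|.
Proof.
have [->|a0] := eqVneq a 0.
  by rewrite inner0l normr0 mul0r.
have [->|b0] := eqVneq b 0.
  by rewrite inner_sym inner0l normr0 mulr0.
have ab0 : 0 < `|a| * `|b| by rewrite mulr_gt0 ?normr_gt0.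
(* This square expands to [2 |a| |b| (|a| |b| - inner a b)]; the positive factor is then
   cancelled. *)
have := sqr_ge0 `|(- `|b|) *: a + `|a| *: b|.
rewrite normD_sqr !normrZ innerZl innerZr normrN !normr_id => h.
by rewrite -(ler_pM2l ab0); nra.
Qed.

(** * Resolvent steps seen from a zero of the operator *)

Lemma resolvent_firm {R : realType} {H : hilbertType R} (A : H -> set H)
    (g : R) (x p z : H) : Defs.monotone A -> 0 < g -> resolvent g A x p -> zer A z ->
  `|p - z| ^+ 2 + `|x - p| ^+ 2 <= `|x - z| ^+ 2.
Proof.
move=> monoA g0 [u Apu <-] Az.
have := monoA _ _ _ _ Apu Az; rewrite subr0 => h.
rewrite [p + _ - p]addrAC subrr add0r [p + _ - z]addrAC (normD_sqr (p - z)) innerZr.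
by rewrite lerD2r lerDl mulr_ge0 // mulr_ge0 // ltW.
Qed.

(** Expand the convex combination with [norm_convex_sqr] and bound [|p - z|^2] by firmness: the
    coefficient of [|x - p|^2] becomes [-t - t(1 - t) = -t(2 - t)]. *)
Lemma relaxed_resolvent_le {R : realType} {H : hilbertType R} (A : H -> set H)
    (g t : R) (x p z : H) : Defs.monotone A -> 0 < g -> 0 <= t ->
  resolvent g A x p -> zer A z ->
  `|(1 - t) *: x + t *: p - z| ^+ 2
    <= `|x - z| ^+ 2 - t * (2 - t) * `|x - p| ^+ 2.
Proof.
move=> monoA g0 t0 Jp Az; have h := resolvent_firm monoA g0 Jp Az.
have -> : (1 - t) *: x + t *: p - z = (1 - t) *: (x - z) + t *: (p - z).
  rewrite !scalerBr addrACA -opprD -scalerDl.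
  by rewrite (_ : 1 - t + t = 1) ?scale1r //; ring.
rewrite norm_convex_sqr (_ : x - z - (p - z) = x - p); last first.
  by rewrite opprB addrA subrK.
nra.
Qed.

(* Real-valued version of dist; meaningful (and equal to it) only when C is
   nonempty, since inf set0 is the junk value 0. *)
Definition Rdist {R : realType} {H : hilbertType R} (x : H) (C : set H) : R :=
  inf [set `|x - y| | y in C].

(** * Distance to a nonempty set *)

Section Dist.
Context {R : realType} {H : hilbertType R}.
Implicit Types (x y z : H) (C : set H).

Let has_lb x C : has_lbound [set `|x - y| | y in C].
Proof. by exists 0 => _ [y _ <-]. Qed.

Lemma distE x C : C !=set0 -> dist x C = (Rdist x C)%:E.
Proof.
move=> [y Cy]; rewrite -ereal_inf_EFin//; last by exists `|x - y|, y.
by rewrite image_comp.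
Qed.

Lemma Rdist_le x y C : C y -> Rdist x C <= `|x - y|.
Proof. by move=> Cy; apply: ge_inf => //; exists y. Qed.

Lemma le_Rdist x C a : C !=set0 -> (forall y, C y -> a <= `|x - y|) ->
  a <= Rdist x C.
Proof.
move=> [y Cy] h; apply: lb_le_inf; first by exists `|x - y|, y.
by move=> _ [z Cz <-]; exact: h.
Qed.

Lemma Rdist_ge0 x C : C !=set0 -> 0 <= Rdist x C.
Proof. by move=> C0; apply: le_Rdist. Qed.

Lemma le_Rdist_sqr x C a : C !=set0 -> (forall y, C y -> a <= `|x - y| ^+ 2) ->
  a <= Rdist x C ^+ 2.
Proof.
(* A negative [a] is trivial; otherwise compare square roots, so that the infimum need not be
   attained. *)
move=> C0 h; have [a0|/ltW a0] := leP 0 a; last first.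
  exact: le_trans a0 (sqr_ge0 _).
rewrite -(sqr_sqrtr a0) lerXn2r ?nnegrE ?sqrtr_ge0 ?Rdist_ge0//.
apply: le_Rdist => // y Cy.
by rewrite -(ger0_norm (normr_ge0 (x - y))) -sqrtr_sqr ler_wsqrtr// h.
Qed.

Lemma Rdist_triangle x y C : C !=set0 -> Rdist x C <= `|x - y| + Rdist y C.
Proof.
move=> C0; rewrite -lerBlDl; apply: le_Rdist => // z Cz.
by rewrite lerBlDl (le_trans (Rdist_le x Cz))// ler_distD.
Qed.

End Dist.

(** * One-step contraction of the distance to the zeros *)

(** Subregularity is applied at [p], not at [x]: firmness against [xbar] keeps [p] in the ball, and
    [(x - p) / g] is an element of [A p]. *)
Lemma subregular_resolvent {R : realType} {H : hilbertType R} (A : H -> set H)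
    (kappa delta g : R) (xbar x p : H) :
  Defs.monotone A -> zer A xbar -> metrically_subregular A xbar 0 kappa delta ->
  0 < g -> closed_ball_ Num.norm xbar delta x -> resolvent g A x p ->
  Rdist p (zer A) <= kappa / g * `|x - p|.
Proof.
move=> monoA Axbar [k0 d0 sub] g0 xball Jp.
have pball : closed_ball_ Num.norm xbar delta p.
  have := resolvent_firm monoA g0 Jp Axbar => h.
  rewrite /closed_ball_ /= distrC (le_trans _ xball)// [X in _ <= X]distrC.
  rewrite -(@ler_pXn2r _ 2)// ?nnegrE//.
  by apply: le_trans h; rewrite lerDl sqr_ge0.
have := sub _ pball; rewrite distE; last by exists xbar.
case: Jp => u Apu <-; rewrite [p + _ - p]addrAC subrr add0r normrZ gtr0_norm//.
rewrite mulrA divfK ?gt_eqF// => /le_trans h.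
rewrite -lee_fin; apply: h; rewrite EFinM lee_pmul2l//.
by apply: ereal_inf_lbound; exists u => //; rewrite sub0r normrN.
Qed.

Lemma proximal_step_contraction {R : realType} {H : hilbertType R}
    (A : H -> set H) (kappa delta g : R) (xbar x p : H) :
  Defs.monotone A -> zer A xbar -> metrically_subregular A xbar 0 kappa delta ->
  0 < g -> closed_ball_ Num.norm xbar delta x -> resolvent g A x p ->
  Rdist p (zer A) <=
    1 / Num.sqrt (1 + g ^+ 2 / kappa ^+ 2) * Rdist x (zer A).
Proof.
move=> monoA Axbar sub g0 xball Jp.
have Z0 : zer A !=set0 by exists xbar.
have h := subregular_resolvent monoA Axbar sub g0 xball Jp.
have [k0 _ _] := sub.
have s0 : 0 < 1 + g ^+ 2 / kappa ^+ 2.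
  by rewrite ltr_wpDr// divr_ge0 ?sqr_ge0.
rewrite mulrAC ler_pdivlMr ?sqrtr_gt0// mul1r.
rewrite -(@ler_pXn2r _ 2)// ?nnegrE ?mulr_ge0 ?sqrtr_ge0 ?Rdist_ge0//.
(* With d the distance from [p] to the zeros, d^2 is at most [|p - z|^2] and [(g / kappa)^2] d^2 is
   at most [|x - p|^2]; firmness bounds their sum by [|x - z|^2]. *)
rewrite exprMn sqr_sqrtr ?(ltW s0)//; apply: le_Rdist_sqr => // z Az.
apply: le_trans (resolvent_firm monoA g0 Jp Az).
rewrite mulrDr mulr1; apply: lerD.
  by rewrite lerXn2r ?nnegrE ?Rdist_ge0 ?Rdist_le.
rewrite -expr_div_n -exprMn.
rewrite lerXn2r ?nnegrE ?mulr_ge0 ?Rdist_ge0 ?invr_ge0 ?(ltW g0) ?(ltW k0)//.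
by rewrite mulrC -[g / _]invf_div ler_pdivrMl ?divr_gt0.
Qed.

(** The distance from [x] to the zeros is at most [|x - p|] plus that from [p], hence at most
    [(1 + kappa / g) |x - p|]. This bounds from below the decrease [t(2 - t) |x - p|^2]. *)
Lemma relaxed_step_contraction {R : realType} {H : hilbertType R}
    (A : H -> set H) (kappa delta g t : R) (xbar x p : H) :
  Defs.monotone A -> zer A xbar -> metrically_subregular A xbar 0 kappa delta ->
  0 < g -> 0 <= t <= 2 ->
  closed_ball_ Num.norm xbar delta x -> resolvent g A x p ->
  Rdist ((1 - t) *: x + t *: p) (zer A) <=
    Num.sqrt (1 - t * (2 - t) * (1 / (1 + kappa / g) ^+ 2)) * Rdist x (zer A).
Proof.
move=> monoA Axbar sub g0 /andP[t0 t2] xball Jp.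
have Z0 : zer A !=set0 by exists xbar.
have h := subregular_resolvent monoA Axbar sub g0 xball Jp.
have [k0 _ _] := sub.
have r0 : 0 < kappa / g by rewrite divr_gt0.
set r := kappa / g in h r0 *.
have w1 : 0 < (1 + r) ^+ 2 by rewrite exprn_gt0// addr_gt0.
have tt0 : 0 <= t * (2 - t) by rewrite mulr_ge0// subr_ge0.
(* Rules out the default value 0 of [Num.sqrt] at negative reals; [1 - t(2 - t)] is [(1 - t)^2]. *)
have rho0 : 0 <= 1 - t * (2 - t) * (1 / (1 + r) ^+ 2).
  rewrite subr_ge0 mul1r ler_pdivrMr// mul1r (@le_trans _ _ 1)//.
    by rewrite -subr_ge0 (_ : _ - _ = (1 - t) ^+ 2) ?sqr_ge0//; ring.
  by rewrite exprn_ege1// lerDl ltW.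
rewrite -(@ler_pXn2r _ 2)// ?nnegrE ?mulr_ge0 ?sqrtr_ge0 ?Rdist_ge0//.
rewrite exprMn sqr_sqrtr// mulrBl !mul1r lerBrDr.
apply: le_Rdist_sqr => // z Az.
have := relaxed_resolvent_le monoA g0 t0 Jp Az; rewrite lerBrDr.
apply: le_trans; apply: lerD.
  by rewrite lerXn2r ?nnegrE ?Rdist_ge0 ?Rdist_le.
rewrite -[leLHS]mulrA; apply: ler_wpM2l => //.
rewrite ler_pdivrMl// -exprMn lerXn2r ?nnegrE ?Rdist_ge0//.
  by rewrite mulr_ge0// addr_ge0// ltW.
by rewrite (le_trans (Rdist_triangle x p Z0))// mulrDl mul1r lerD2l.
Qed.

(** * Closedness of the set of zeros *)

Lemma zer_closed {R : realType} {H : hilbertType R} (A : H -> set H) (z : H) :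
  maximally_monotone A -> zer A !=set0 -> Rdist z (zer A) <= 0 -> zer A z.
Proof.
move=> [monoA maxA] Z0 dz.
(* If [inner (y - z) v] were negative, monotonicity at each zero [z'] and Cauchy-Schwarz would keep
   [|z - z'|] above a positive constant. Dividing by [|v| + 1] covers [v = 0]. *)
have key y v : A y v -> 0 <= inner (y - z) v.
  move=> Ayv; rewrite leNgt; apply/negP => s0.
  have v1 : 0 < `|v| + 1 by rewrite ltr_wpDl.
  suff : - inner (y - z) v / (`|v| + 1) <= Rdist z (zer A).
    by move=> /le_trans /(_ dz); rewrite ler_pdivrMr// mul0r oppr_le0 leNgt s0.
  apply: le_Rdist => // z' Az'; rewrite ler_pdivrMr//.
  have := monoA _ _ _ _ Ayv Az'; rewrite subr0 => h.
  have := inner_le_norm (z - z') v.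
  have -> : inner (z - z') v = inner (y - z') v - inner (y - z) v.
    rewrite -mulN1r -innerZl -innerDl scaleN1r opprB.
    by rewrite [_ + (z - y)]addrC addrA subrK.
  have : 0 <= `|z - z'| by []; rewrite mulrDr mulr1; lra.
(* Adding (z, 0) to the graph of A keeps it monotone. *)
pose B y : set H := [set v | A y v \/ (y = z /\ v = 0)].
suff : B z `<=` A z by apply; right.
apply: maxA; last by move=> y v; left.
move=> a b u v [Aau|[-> ->]] [Abv|[-> ->]].
- exact: monoA.
- by rewrite subr0; exact: key.
- rewrite sub0r -(opprB b z) -(scaleN1r v) -(scaleN1r (b - z)).
  by rewrite innerZl innerZr mulrA mulrNN !mul1r; exact: key.
- by rewrite !subrr inner0l.
Qed.

(** * Geometric decay and R-linear convergence *)

Lemma geometric_R_linear {R : realType} {H : hilbertType R} (y : nat -> H)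
    (yhat : H) (K : nat) (M q : R) : 0 < q < 1 ->
  (forall k, (K <= k)%N -> `|y k - yhat| <= M * q ^+ k) ->
  converges_R_linearly y yhat.
Proof.
move=> /andP[q0 q1] h; split.
  apply/cvgrPdist_lt => e e0.
  have qn1 : `|q| < 1 by rewrite gtr0_norm.
  have /cvgr0Pnorm_lt /(_ _ e0) [N _ HN] := cvg_geometric M qn1.
  exists (maxn K N) => // k /=; rewrite geq_max => /andP[Kk Nk].
  rewrite distrC (le_lt_trans (h _ Kk))// (le_lt_trans (ler_norm _))//.
  exact: HN.
(* The k-th root of [M q^k] may exceed [q]; a rate [r] strictly between [q] and 1 absorbs [M], since
   [M (q / r)^k < 1] eventually. *)
pose r := (1 + q) / 2.
have qr : q < r by rewrite /r; lra.
have r1 : r < 1 by rewrite /r; lra.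
have r0 : 0 < r by rewrite (lt_trans q0).
have qrn1 : `|q / r| < 1.
  by rewrite (gtr0_norm (divr_gt0 q0 r0)) ltr_pdivrMr// mul1r.
have /cvgr0Pnorm_lt /(_ _ ltr01) [N _ HN] := cvg_geometric M qrn1.
apply: (@le_lt_trans _ _ r%:E); last by rewrite lte_fin.
apply: ge_ereal_inf.
(* The limsup is bounded by the supremum over one tail; starting at 1 or later avoids the junk
   exponent at index 0. *)
exists (ereal_sup [set (`|y k - yhat| `^ k%:R^-1)%:E
  | k in [set k | (maxn (maxn K N) 1 <= k)%N]]).
  exists [set k | (maxn (maxn K N) 1 <= k)%N] => //.
  by exists (maxn (maxn K N) 1).
apply: ge_ereal_sup => _ [k /= + <-].
rewrite !geq_max => /andP[/andP[Kk Nk] k1]; rewrite lee_fin.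
have k0 : k%:R != 0 :> R by rewrite pnatr_eq0 -lt0n.
have -> : r = (r ^+ k) `^ k%:R^-1.
  by rewrite -powR_mulrn ?ltW// -powRrM divff// powRr1// ltW.
apply: ge0_ler_powR; rewrite ?nnegrE ?invr_ge0 ?exprn_ge0 ?(ltW r0)//.
apply/ltW/(le_lt_trans (h _ Kk)).
have := le_lt_trans (ler_norm _) (HN _ Nk).
by rewrite /geometric/= expr_div_n mulrA ltr_pdivrMr ?exprn_gt0// mul1r.
Qed.

(** [C] is not assumed closed, so the limit is only shown to be at distance 0; [zer_closed] later
    turns this into membership. *)
Lemma fejer_R_linear {R : realType} {H : hilbertType R} (y : nat -> H)
    (C : set H) (K : nat) (q : R) : C !=set0 ->
  (forall z k, C z -> `|y k.+1 - z| <= `|y k - z|) -> q < 1 ->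
  (forall k, (K <= k)%N -> Rdist (y k.+1) C <= q * Rdist (y k) C) ->
  exists yhat, Rdist yhat C <= 0 /\ converges_R_linearly y yhat.
Proof.
move=> C0 fejer q1 contr.
have mono z k m : C z -> (k <= m)%N -> `|y m - z| <= `|y k - z|.
  move=> Cz /subnK <-; elim: (m - k)%N => // n; apply: le_trans.
  exact: fejer.
(* Pass through any z in C: |y_m - y_k| <= |y_m - z| + |y_k - z| <= 2|y_k - z|. *)
have close k m : (k <= m)%N -> `|y m - y k| <= 2 * Rdist (y k) C.
  move=> km; rewrite mulrC -ler_pdivrMr//; apply: le_Rdist => // z Cz.
  rewrite ler_pdivrMr// (le_trans (ler_distD z _ _))// [`|z - _|]distrC.
  by rewrite mulr_natr mulr2n lerD2r mono.
(* [q] may be nonpositive, whereas a positive rate is needed to divide by [r ^+ K]. *)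
pose r := Num.max q 2^-1.
have r0 : 0 < r by rewrite lt_max invr_gt0 ltr0n orbT.
have r1 : r < 1 by rewrite gt_max q1 invf_lt1 ?ltr1n.
have rn1 : `|r| < 1 by rewrite gtr0_norm.
pose M := Rdist (y K) C / r ^+ K.
have geom k : (K <= k)%N -> Rdist (y k) C <= M * r ^+ k.
  elim: k => [|k IH]; first by rewrite leqn0 => /eqP K0; rewrite /M K0 expr0 divr1 mulr1.
  rewrite leq_eqVlt => /predU1P[<-|Kk].
    by rewrite /M divfK// expf_neq0// gt_eqF.
  apply: (le_trans (contr _ Kk)); apply: (@le_trans _ _ (r * Rdist (y k) C)).
    by apply: ler_wpM2r; rewrite ?Rdist_ge0// le_max lexx.
  by rewrite exprS mulrCA ler_pM2l// IH.
have small e : 0 < e -> exists2 N, (K <= N)%N & M * r ^+ N < e.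
  move=> e0; have /cvgr0Pnorm_lt /(_ _ e0) [N _ HN] := cvg_geometric M rn1.
  exists (maxn K N); first exact: leq_maxl.
  exact: le_lt_trans (ler_norm _) (HN _ (leq_maxr K N)).
have /cauchy_cvgP/cvg_ex[/= yhat yhatP] : cauchy (y @ \oo).
  apply: cauchy_exP => e e0.
  have [N KN HN] : exists2 N, (K <= N)%N & M * r ^+ N < e / 2.
    by apply: small; rewrite divr_gt0.
  exists (y N); exists N => // m /= Nm; rewrite -ball_normE /=.
  rewrite distrC (le_lt_trans (close _ _ Nm))//.
  by rewrite mulrC -ltr_pdivlMr// (le_lt_trans (geom _ KN)).
(* Let m tend to infinity in [close], with an additive error [e]. *)
have yhat_le k : (K <= k)%N -> `|y k - yhat| <= (2 * M) * r ^+ k.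
  move=> Kk; apply/ler_addgt0Pr => e e0.
  have /cvgrPdist_le/(_ _ e0)[N _ HN] := yhatP.
  have := HN _ (leq_maxr k N); rewrite distrC => h.
  apply: le_trans (ler_distD (y (maxn k N)) _ _) _; apply: lerD => //.
  rewrite distrC (le_trans (close _ _ (leq_maxl k N)))//.
  by rewrite -mulrA ler_pM2l// geom.
exists yhat; split; last first.
  by apply: geometric_R_linear yhat_le; rewrite r0.
apply/ler_addgt0Pr => e e0; rewrite add0r.
(* One third for the distance from [y N] to [C], two thirds for [|y N - yhat|]. *)
have [N KN HN] : exists2 N, (K <= N)%N & M * r ^+ N < e / 3.
  by apply: small; rewrite divr_gt0.
apply: le_trans (Rdist_triangle _ (y N) C0) _.
have := yhat_le _ KN; have := geom _ KN; rewrite distrC; lra.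
Qed.

(** * Assembly of the convergence results *)

Theorem proposition5p1 (R : realType) (H : hilbertType R) (A : H -> set H)
  (A_maxmono : maximally_monotone A) (zerA_neq0 : zer A !=set0)
  (x : nat -> H) (lambda c : nat -> R)
  (lambda_itv : forall k, 0 <= lambda k <= 2)
  (c_gt0 : forall k, 0 < c k)
  (x_rec : forall k, exists2 p, resolvent (c k) A (x k) p &
     x k.+1 = (1 - lambda k) *: x k + lambda k *: p)
  (xbar : H) (xbar_zer : zer A xbar)
  (kappa delta : R)
  (A_subreg : metrically_subregular A xbar 0 kappa delta) :
  let cinf := inf (range c) in
  let rho k :=
    Num.sqrt (1 - lambda k * (2 - lambda k) * (1 / (1 + kappa / c k) ^+ 2)) in
  (* (i) *)
  (closed_ball_ Num.norm xbar delta (x 0%N) ->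
   (forall k, lambda k = 1) ->
     (* (a) *)
     (forall k, (dist (x k.+1) (zer A) <=
        (1 / Num.sqrt (1 + c k ^+ 2 / kappa ^+ 2))%:E * dist (x k) (zer A))%E)
     (* (b) *)
     /\ (0 < cinf ->
         exists xhat, zer A xhat /\ converges_R_linearly x xhat))
  (* (ii) *)
  /\ (x @ \oo --> xbar ->
     (* (a) *)
     ((* (1) *)
      (exists K : nat, forall k, (K <= k)%N ->
         (dist (x k.+1) (zer A) <= (rho k)%:E * dist (x k) (zer A))%E)
      (* (2) *)
      /\ (0 < cinf ->
          0 < inf (range lambda) ->
          inf (range lambda) <= sup (range lambda) ->
          sup (range lambda) < 2 ->
          exists xhat, zer A xhat /\ converges_R_linearly x xhat))
     (* (b) *)
     /\ ((forall k, lambda k = 1) ->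
        (* (1) *)
        (exists K : nat, forall k, (K <= k)%N ->
           (dist (x k.+1) (zer A) <=
              (1 / Num.sqrt (1 + c k ^+ 2 / kappa ^+ 2))%:E *
              dist (x k) (zer A))%E)
        (* (2) *)
        /\ (0 < cinf ->
            exists xhat, zer A xhat /\ converges_R_linearly x xhat))).

Proof.
move=> cinf rho.
have [monoA _] := A_maxmono; have [k0 d0 _] := A_subreg.
have fejer z k : zer A z -> `|x k.+1 - z| <= `|x k - z|.
  move=> Az; have [p Jkp ->] := x_rec k; have /andP[l0 l2] := lambda_itv k.
  rewrite -(@ler_pXn2r _ 2)// ?nnegrE//.
  apply: le_trans (relaxed_resolvent_le monoA (c_gt0 k) l0 Jkp Az) _.
  by rewrite gerBl !mulr_ge0// subr_ge0.
have cinf_le k : cinf <= c k.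
  by apply: ge_inf; [exists 0 => _ [j _ <-]; exact: ltW|exists k].
have prox k : lambda k = 1 -> closed_ball_ Num.norm xbar delta (x k) ->
    Rdist (x k.+1) (zer A) <=
      1 / Num.sqrt (1 + c k ^+ 2 / kappa ^+ 2) * Rdist (x k) (zer A).
  move=> l1 ballk; have [p Jkp ->] := x_rec k.
  rewrite l1 subrr scale0r add0r scale1r.
  exact: proximal_step_contraction ballk Jkp.
have relax k : closed_ball_ Num.norm xbar delta (x k) ->
    Rdist (x k.+1) (zer A) <= rho k * Rdist (x k) (zer A).
  move=> ballk; have [p Jkp ->] := x_rec k.
  exact: relaxed_step_contraction ballk Jkp.
have R_linear K q : q < 1 ->
    (forall k, (K <= k)%N -> Rdist (x k.+1) (zer A) <= q * Rdist (x k) (zer A)) ->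
    exists xhat, zer A xhat /\ converges_R_linearly x xhat.
  move=> q1 /(fejer_R_linear zerA_neq0 fejer q1)[xhat [dx Rx]].
  by exists xhat; split => //; exact: zer_closed.
have prox_R_linear K : 0 < cinf -> (forall k, lambda k = 1) ->
    (forall k, (K <= k)%N -> closed_ball_ Num.norm xbar delta (x k)) ->
    exists xhat, zer A xhat /\ converges_R_linearly x xhat.
  move=> cinf0 l1 ballK.
  have s0 a : 0 < 1 + a ^+ 2 / kappa ^+ 2 :> R.
    by rewrite ltr_wpDr// divr_ge0 ?sqr_ge0.
  (* The factor decreases in [c k], so its value at [cinf] is a uniform rate. *)
  apply: (R_linear K (1 / Num.sqrt (1 + cinf ^+ 2 / kappa ^+ 2))).
    rewrite ltr_pdivrMr ?sqrtr_gt0// mul1r -[ltLHS]sqrtr1 ltr_sqrt//.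
    by rewrite ltrDl divr_gt0 ?exprn_gt0.
  move=> k Kk; apply: le_trans (prox k (l1 k) (ballK k Kk)) _.
  apply: ler_wpM2r; first exact: Rdist_ge0.
  rewrite !div1r lef_pV2 ?posrE ?sqrtr_gt0// ler_wsqrtr// lerD2l ler_pM2r.
    by rewrite lerXn2r ?nnegrE ?(ltW cinf0) ?(ltW (c_gt0 k)).
  by rewrite invr_gt0 exprn_gt0.
split.
  move=> ball0 l1.
  (* Fejer monotonicity with respect to [xbar] keeps every iterate in the ball. *)
  have ball k : closed_ball_ Num.norm xbar delta (x k).
    elim: k => // k; apply: le_trans; rewrite /= !(distrC xbar).
    exact: fejer.
  split=> [k|cinf0].
    by rewrite !distE// -EFinM lee_fin prox.
  exact: (prox_R_linear 0%N).
move=> xcvg.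
have [K _ ballK] : \forall k \near \oo, closed_ball_ Num.norm xbar delta (x k).
  by move/cvgrPdist_le : xcvg; apply.
split; split.
- by exists K => k Kk; rewrite !distE// -EFinM lee_fin relax//; exact: ballK.
- move=> cinf0; set m := inf _; set M := sup _ => m0 _ M2.
  have lambda_ge k : m <= lambda k.
    apply: ge_inf; last by exists k.
    by exists 0 => _ [j _ <-]; have /andP[] := lambda_itv j.
  have lambda_le k : lambda k <= M.
    apply: ub_le_sup; last by exists k.
    by exists 2 => _ [j _ <-]; have /andP[] := lambda_itv j.
  have r0 a : 0 < a -> 0 < (1 + kappa / a) ^+ 2.
    by move=> a0; rewrite exprn_gt0// addr_gt0// divr_gt0.
  (* Bound [lambda k] below by [m], [2 - lambda k] below by [2 - M], and [c k] below by [cinf]: each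
     replacement can only increase the rate. *)
  pose q := 1 - m * (2 - M) * (1 / (1 + kappa / cinf) ^+ 2).
  apply: (R_linear K (Num.sqrt q)).
    rewrite -[ltRHS]sqrtr1 ltr_sqrt// /q gtrBl.
    by rewrite !mulr_gt0 ?subr_gt0 ?div1r ?invr_gt0 ?r0.
  move=> k Kk; apply: le_trans (relax k (ballK k Kk)) _.
  apply: ler_wpM2r; first exact: Rdist_ge0.
  rewrite ler_wsqrtr// lerD2l lerN2; apply: ler_pM.
  + by rewrite mulr_ge0 ?subr_ge0 ?(ltW m0) ?(ltW M2).
  + by rewrite div1r invr_ge0 ltW ?r0.
  + by apply: ler_pM; rewrite ?subr_ge0 ?(ltW m0) ?(ltW M2) ?lerD2l ?lerN2.
  + rewrite !div1r lef_pV2 ?posrE ?r0//.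
    rewrite lerXn2r ?nnegrE ?addr_ge0 ?divr_ge0 ?(ltW k0) ?(ltW cinf0)
      ?(ltW (c_gt0 k))//.
    by rewrite lerD2l ler_pM2l// lef_pV2 ?posrE.
- exists K => k Kk; rewrite !distE// -EFinM lee_fin prox//.
  exact: ballK.
- by move=> cinf0; exact: (prox_R_linear K).
Qed.
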